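(* Let $C_{(\geq,<)}(x,y)$ be the bivariate generating function of the Catalan words avoiding the ordered pair of relations $(\geq,<)$, where $x$ marks the length and $y$ marks the number of descents. Then $$C_{(\geq,<)}(x,y)=\frac {1-x+x^2-x^2y}{1-2x+x^2-x^2y}.$$
   Context: A Catalan word of length $n$ is a word $w=w_1w_2\cdots w_n$ over the non-negative integers with $w_1=0$ and $0\leq w_i\leq w_{i-1}+1$ for $i=2,\dots,n$; the empty word is the unique Catalan word of length $0$. For relations $X,Y\in\{<,>,\leq,\geq,=,\neq\}$, a word $w$ contains the pattern $(X,Y)$ if there is an index $i\geq 1$ (with $i+2\le n$) such that $w_i\,X\,w_{i+1}$ and $w_{i+1}\,Y\,w_{i+2}$; otherwise $w$ avoids $(X,Y)$. The number of descents $\mathrm{des}(w)$ is the number of indices $i$ with $w_i>w_{i+1}$. The bivariate generating function is $C_{(X,Y)}(x,y)=\sum_{w}x^{|w|}y^{\mathrm{des}(w)}$, the sum being over all Catalan words $w$ (of any length $|w|\geq 0$) avoiding $(X,Y)$. Identities are between formal power series in $x$ with coefficients polynomials in $y$. *)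

(* Defs.v *)
From mathcomp Require Import all_boot all_order all_algebra.

Set Implicit Arguments.
Unset Strict Implicit.
Unset Printing Implicit Defensive.

Import GRing.Theory.

(* Words are 0-indexed: w_i is [nth 0 w (i - 1)]. *)

(* [head 0 [::] = 0], so the empty word is Catalan. *)
Definition catalan_word (w : seq nat) : bool :=
  (head 0 w == 0) && sorted (fun a b => b <= a.+1) w.

Definition contains_pattern (X Y : rel nat) (w : seq nat) : bool :=
  has (fun i => X (nth 0 w i) (nth 0 w i.+1)
                && Y (nth 0 w i.+1) (nth 0 w i.+2))
      (iota 0 (size w - 2)).

Definition avoids_pattern (X Y : rel nat) (w : seq nat) : bool :=
  ~~ contains_pattern X Y w.

Definition des (w : seq nat) : nat :=
  count (fun i => nth 0 w i > nth 0 w i.+1) (iota 0 (size w - 1)).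

(* The letters of a Catalan word of length n are less than n; this is why
   [catalan_gf] may sum over words on the alphabet 'I_n. *)
Lemma catalan_word_bound (w : seq nat) :
  catalan_word w -> all (fun a => a < size w) w.
Proof.
case: w => [|a w] //= /andP[/eqP /= -> {a}] /=.
rewrite -[(size w).+1]add0n; elim: w 0 => [|b w IHw] a //= /andP[leb /IHw bw].
have le_bound : b + (size w).+1 <= a + (size w).+2.
  by rewrite [leqRHS]addnS -addSn leq_add2r.
apply/andP; split; first by apply: leq_trans le_bound; rewrite addnS ltnS leq_addr.
by apply: sub_all bw => c ltc; apply: leq_trans le_bound.
Qed.

Local Open Scope ring_scope.

(* Formal power series are coefficient sequences, compared with [=1]. *)
Definition fps (R : Type) : Type := nat -> R.

Section PowerSeries.
Variable R : comUnitRingType.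

Definition fps_of_poly (p : {poly R}) : fps R := fun n => p`_n.

Definition fps_mul (a b : fps R) : fps R :=
  fun n => \sum_(i < n.+1) a i * b (n - i)%N.

(* The first n coefficients of 1 / a: the coefficients b_m of the inverse are
   determined by \sum_(i <= m) b_i a_(m - i) = [m = 0]. *)
Fixpoint fps_inv_prefix (a : fps R) (n : nat) : seq R :=
  if n is m.+1 then
    let s := fps_inv_prefix a m in
    rcons s ((a 0%N)^-1 * ((m == 0%N)%:R - \sum_(i < m) s`_i * a (m - i)%N))
  else [::].

Definition fps_inv (a : fps R) : fps R := fun n => (fps_inv_prefix a n.+1)`_n.

Definition fps_div (a b : fps R) : fps R := fps_mul a (fps_inv b).

Lemma size_fps_inv_prefix (a : fps R) n : size (fps_inv_prefix a n) = n.
Proof. by elim: n => //= n IHn; rewrite size_rcons IHn. Qed.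

Lemma nth_fps_inv_prefix (a : fps R) n i :
  (i < n)%N -> (fps_inv_prefix a n)`_i = fps_inv a i.
Proof.
elim: n => // n IHn; rewrite ltnS leq_eqVlt => /predU1P[-> //|ltin].
by rewrite /= nth_rcons size_fps_inv_prefix ltin IHn.
Qed.

Lemma fps_mulV (a : fps R) :
  a 0%N \is a GRing.unit -> fps_mul (fps_inv a) a =1 fps_of_poly 1.
Proof.
move=> ua n; rewrite /fps_of_poly coef1 /fps_mul big_ord_recr /= subnn.
rewrite {2}/fps_inv /= nth_rcons size_fps_inv_prefix ltnn eqxx.
rewrite mulrAC mulVr // mul1r.
under [X in _ - X]eq_bigr => i _ do rewrite nth_fps_inv_prefix //.
by rewrite addrC subrK.
Qed.

End PowerSeries.

(* Series in x whose coefficients are polynomials in y = 'X; its n-th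
   coefficient runs over the words of length n. *)
Definition catalan_gf (X Y : rel nat) : fps {poly int} :=
  fun n => \sum_(w : n.-tuple 'I_n
                  | catalan_word (map val w) && avoids_pattern X Y (map val w))
             'X^(des (map val w)).

(* Main.v *)
Require Import Defs.
From mathcomp Require Import all_boot all_order all_algebra.
From mathcomp Require Import ring.

Import GRing.Theory.

(** A word avoids [(>=, <)] exactly when, after its first weak descent, it is
    weakly decreasing.  So a nonempty Catalan word avoiding the pattern is
    [0 1 ... k] followed by a weakly decreasing word of length [m] with letters
    at most [k].  The descent polynomials [D k m] of these tails satisfy
    [D (k+1) (m+1) = D k (m+1) + D (k+1) m - (1 - y) D k m] with boundary
    values [1], so the antidiagonal sums [S n] of [D] satisfy
    [S (n+2) = 2 S (n+1) - (1 - y) S n], which is the recurrence encoded by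
    the denominator. *)

(** * Pattern avoidance and descents, letter by letter *)

Lemma contains_pattern_cons (X Y : rel nat) a b c w :
  contains_pattern X Y [:: a, b, c & w] =
  X a b && Y b c || contains_pattern X Y [:: b, c & w].
Proof.
by rewrite /contains_pattern /= !subSS !subn0 /= (iotaDl 1 0) has_map.
Qed.

Lemma des_cons a b w : des [:: a, b & w] = (b < a) + des (b :: w).
Proof.
by rewrite /des /= !subSS !subn0 /= (iotaDl 1 0) count_map.
Qed.

Notation avoids_ge_lt := (avoids_pattern (fun a b => b <= a) (fun a b => a < b)).

Lemma avoids_ge_lt_rise a b w :
  a < b -> avoids_ge_lt [:: a, b & w] = avoids_ge_lt (b :: w).
Proof.
case: w => [|c w] lt_ab //.
by rewrite /avoids_pattern contains_pattern_cons leqNgt lt_ab.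
Qed.

(** Avoidance forces the letter [c] after the weak descent from [a] to [b] to satisfy [c <= b]. This
    is again a weak descent, so the condition propagates to the end, and it implies the Catalan
    bound [c <= b.+1]. *)
Lemma avoids_ge_lt_weak_descent a b w : b <= a ->
  path (fun a b => b <= a.+1) b w && avoids_ge_lt [:: a, b & w] = path geq b w.
Proof.
elim: w a b => [|c w IHw] a b le_ba //=.
rewrite /avoids_pattern contains_pattern_cons negb_or le_ba /= -leqNgt.
case: (leqP c b) => [le_cb|]; last by rewrite /= andbF.
by rewrite -(IHw _ _ le_cb) leqW.
Qed.

(** * Arithmetic of power series *)

Local Open Scope ring_scope.

(** Truncation lets products of series inherit commutativity and associativity from [{poly R}]. *)
Lemma fps_mul_poly (R : comUnitRingType) (a b : fps R) N n : (n < N)%N ->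
  fps_mul a b n = (\poly_(i < N) a i * \poly_(i < N) b i)`_n.
Proof.
move=> ltnN; rewrite coefM; apply: eq_bigr => i _; rewrite !coef_poly.
have ltN j : (j <= n)%N -> (j < N)%N by move/leq_ltn_trans; apply.
by rewrite !ltN ?leq_subr // -ltnS.
Qed.

Lemma fps_mulC (R : comUnitRingType) (a b : fps R) : fps_mul a b =1 fps_mul b a.
Proof. by move=> n; rewrite !(@fps_mul_poly _ _ _ n.+1) // mulrC. Qed.

Lemma eq_fps_mul (R : comUnitRingType) (a a' b b' : fps R) :
  a =1 a' -> b =1 b' -> fps_mul a b =1 fps_mul a' b'.
Proof. by move=> ea eb n; apply: eq_bigr => i _; rewrite ea eb. Qed.

Lemma fps_mulA (R : comUnitRingType) (a b c : fps R) :
  fps_mul a (fps_mul b c) =1 fps_mul (fps_mul a b) c.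
Proof.
move=> n; pose p (f : fps R) := \poly_(i < n.+1) f i.
have pE f i : (i <= n)%N -> f i = (p f)`_i by rewrite coef_poly ltnS => ->.
transitivity (p a * (p b * p c))`_n.
  rewrite coefM; apply: eq_bigr => i _.
  by rewrite (@fps_mul_poly _ b c n.+1) ?ltnS ?leq_subr // -pE // -ltnS.
rewrite mulrA coefM; apply: eq_bigr => i _.
by rewrite (@fps_mul_poly _ a b n.+1) // -[(p c)`__]pE ?leq_subr.
Qed.

Lemma fps_mul1 (R : comUnitRingType) (a : fps R) :
  fps_mul a (fps_of_poly 1) =1 a.
Proof.
move=> n; rewrite fps_mulC /fps_mul big_ord_recl /fps_of_poly coef1 mul1r subn0.
by rewrite big1 ?addr0 // => i _; rewrite coef1 mul0r.
Qed.

Lemma fps_div_unique (R : comUnitRingType) (a b c : fps R) :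
  b 0%N \is a GRing.unit -> fps_mul c b =1 a -> c =1 fps_div a b.
Proof.
move=> ub cb n; rewrite /fps_div -(@eq_fps_mul _ _ _ (fps_inv b) _ cb) //.
rewrite -fps_mulA (@eq_fps_mul _ c c _ (fps_of_poly 1)) ?fps_mul1 //.
by move=> m; rewrite fps_mulC fps_mulV.
Qed.

(** * Descent polynomials as sums over words *)

Lemma big_tuple_nil (R : nmodType) (T : finType) (P : pred (seq T))
    (F : seq T -> R) : P [::] ->
  \sum_(w : 0.-tuple T | P w) F w = F [::].
Proof.
move=> P0; rewrite (eq_bigl (pred1 [tuple])) ?big_pred1_eq // => w.
by rewrite tuple0 /= P0 eqxx.
Qed.

Lemma big_tuple_cons (R : nmodType) (T : finType) m (P : pred (seq T))
    (F : seq T -> R) :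
  \sum_(w : m.+1.-tuple T | P w) F w =
  \sum_(a : T) \sum_(w : m.-tuple T | P (a :: w)) F (a :: w).
Proof.
rewrite pair_big_dep /=.
rewrite (reindex (fun p : T * m.-tuple T => [tuple of p.1 :: p.2])) //=.
exists (fun w => (thead w, [tuple of behead w])).
  by move=> [a w] _; congr pair; apply: val_inj.
by move=> w _; rewrite [RHS]tuple_eta; apply: val_inj.
Qed.

Lemma sum_ord_widen (R : nmodType) N n (F : nat -> R) : (n <= N)%N ->
  \sum_(i < N) (if (i < n)%N then F i else 0) = \sum_(i < n) F i.
Proof. by move=> le_nN; rewrite -big_mkcond (big_ord_widen _ _ le_nN). Qed.

(** Here [k] is the letter before the tail. A first tail letter equal to [k] makes no descent and
    gives the first summand; a smaller letter [b] makes one, whence the factor ['X]. *)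
Fixpoint dec_poly (k m : nat) : {poly int} :=
  if m is m'.+1 then dec_poly k m' + 'X * \sum_(b < k) dec_poly b m' else 1.

Arguments dec_poly : simpl never.

Lemma dec_polyS k m :
  dec_poly k m.+1 = dec_poly k m + 'X * \sum_(b < k) dec_poly b m.
Proof. by []. Qed.

Lemma dec_poly0 m : dec_poly 0 m = 1.
Proof. by elim: m => // m IHm; rewrite dec_polyS IHm big_ord0 mulr0 addr0. Qed.

(** Subtracting the recursion at [k] from the one at [k.+1] leaves a single term of the sum over
    [b]. *)
Lemma dec_polySS k m :
  dec_poly k.+1 m.+1 =
  dec_poly k m.+1 + dec_poly k.+1 m - (1 - 'X) * dec_poly k m.
Proof. by rewrite !dec_polyS big_ord_recr /=; ring. Qed.

Lemma sum_weakly_decreasing N k m : (k < N)%N ->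
  \sum_(v : m.-tuple 'I_N | path geq k (map val v)) 'X^(des (k :: map val v))
  = dec_poly k m.
Proof.
elim: m k => [|m IHm] k lt_kN.
  by rewrite (@big_tuple_nil _ _ (fun v => path geq k (map val v))
    (fun v => 'X^(des (k :: map val v)))).
rewrite (@big_tuple_cons _ _ _ (fun v => path geq k (map val v))
  (fun v => 'X^(des (k :: map val v)))) /=.
transitivity (\sum_(b < N) if (b < k.+1)%N
                           then 'X^(b < k)%N * dec_poly b m else 0).
  apply: eq_bigr => b _; rewrite ltnS.
  case: (boolP (b <= k)%N) => le_bk /=; last by rewrite big_pred0.
  rewrite -IHm // mulr_sumr; apply: eq_bigr => v _.
  by rewrite des_cons exprD.
rewrite (@sum_ord_widen _ _ _ (fun b => 'X^(b < k)%N * dec_poly b m)) //.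
rewrite dec_polyS big_ord_recr /= ltnn mul1r addrC mulr_sumr; congr (_ + _).
by apply: eq_bigr => b _; rewrite ltn_ord.
Qed.

(** The index [i] counts the rises after [k]; the other [m - i] letters decrease weakly from
    [k + i]. The bound on [N] keeps the whole climb inside the alphabet. *)
Lemma sum_catalan_from N k m : (k + m < N)%N ->
  \sum_(v : m.-tuple 'I_N | path (fun a b => b <= a.+1)%N k (map val v)
                            && avoids_ge_lt (k :: map val v))
     'X^(des (k :: map val v))
  = \sum_(i < m.+1) dec_poly (k + i) (m - i).
Proof.
elim: m k => [|m IHm] k lt_kmN.
  by rewrite big_ord1 (@big_tuple_nil _ _
    (fun v => path (fun a b => b <= a.+1)%N k (map val v)
              && avoids_ge_lt (k :: map val v))
    (fun v => 'X^(des (k :: map val v)))).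
have lt_kN : (k < N)%N by apply: leq_ltn_trans lt_kmN; apply: leq_addr.
have lt_k1N : (k.+1 < N)%N.
  by apply: leq_ltn_trans lt_kmN; rewrite addnS ltnS leq_addr.
rewrite big_ord_recl addn0 subn0 -(@sum_weakly_decreasing N) //.
under [X in _ = _ + X]eq_bigr => i _
  do rewrite /= /bump /= add1n subSS addnS -addSn.
rewrite -IHm ?addSnnS //.
rewrite (@big_tuple_cons _ _ _
  (fun v => path (fun a b => b <= a.+1)%N k (map val v)
            && avoids_ge_lt (k :: map val v))
  (fun v => 'X^(des (k :: map val v)))).
rewrite (@big_tuple_cons _ _ _ (fun v => path geq k (map val v))
  (fun v => 'X^(des (k :: map val v)))).
(* The next letter [k.+1] continues the climb, which is the induction hypothesis; any other
   admissible letter is a weak descent and belongs to the term [i = 0]. *)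
rewrite [LHS](bigD1 (Ordinal lt_k1N)) //= addrC; congr (_ + _); last first.
  apply: eq_big => [v|v _]; first by rewrite leqnn /= avoids_ge_lt_rise.
  by rewrite des_cons ltnNge leqnSn.
rewrite [RHS](bigD1 (Ordinal lt_k1N)) //= ltnn [X in X + _]big_pred0 // add0r.
apply: eq_bigr => b ne_b; apply: eq_bigl => v /=.
have ne_bk : (b != k.+1 :> nat) by rewrite -val_eqE in ne_b.
rewrite leq_eqVlt (negbTE ne_bk) /= ltnS.
by case: (boolP (b <= k)%N) => // le_bk; rewrite /= avoids_ge_lt_weak_descent.
Qed.

(** * The recurrence and the generating function *)

Definition antidiag_sum n : {poly int} := \sum_(i < n.+1) dec_poly i (n - i).

Lemma antidiag_sumSS n :
  antidiag_sum n.+2 = 2 * antidiag_sum n.+1 - (1 - 'X) * antidiag_sum n.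
Proof.
(* The same sum is split at its two ends, [k = 0] and [m = 0]. The two boundary values [1] of
   [antidiag_sum n.+2] complete one copy each. *)
have S1 : antidiag_sum n.+1 = 1 + \sum_(i < n.+1) dec_poly i.+1 (n - i).
  by rewrite /antidiag_sum big_ord_recl dec_poly0; congr (_ + _).
have S1' : antidiag_sum n.+1 = \sum_(i < n.+1) dec_poly i (n - i).+1 + 1.
  rewrite /antidiag_sum big_ord_recr /= subnn; congr (_ + _).
  by apply: eq_bigr => i _; rewrite subSn // -ltnS.
have -> : antidiag_sum n.+2 =
    1 + \sum_(i < n.+1) dec_poly i.+1 (n - i).+1 + 1.
  rewrite /antidiag_sum big_ord_recl big_ord_recr /= subnn dec_poly0 addrA.
  congr (_ + _ + _); apply: eq_bigr => i _ /=.
  by rewrite /bump /= add1n subSS subSn // -ltnS.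
under eq_bigr => i _ do rewrite dec_polySS.
rewrite sumrB big_split /= -mulr_sumr -/(antidiag_sum n).
rewrite mulr_natl mulr2n {1}S1' S1; ring.
Qed.

Lemma catalan_gf_ge_lt0 :
  catalan_gf (fun a b => b <= a)%N (fun a b => a < b)%N 0 = 1.
Proof.
by rewrite /catalan_gf (@big_tuple_nil _ _
  (fun v => catalan_word (map val v) && avoids_ge_lt (map val v))
  (fun v => 'X^(des (map val v)))).
Qed.

Lemma catalan_gf_ge_ltS n :
  catalan_gf (fun a b => b <= a)%N (fun a b => a < b)%N n.+1 = antidiag_sum n.
Proof.
rewrite /catalan_gf (@big_tuple_cons _ _ _
  (fun v => catalan_word (map val v) && avoids_ge_lt (map val v))
  (fun v => 'X^(des (map val v)))).
rewrite (bigD1 ord0) //= [X in _ + X]big1 => [|b ne_b].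
  by rewrite addr0 sum_catalan_from.
rewrite big_pred0 // => v; rewrite -val_eqE /= in ne_b.
by rewrite /catalan_word /= (negbTE ne_b).
Qed.

Theorem theorem3p22 :
  let x : {poly {poly int}} := 'X in
  let y : {poly {poly int}} := ('X)%:P in
  catalan_gf (fun a b => (a >= b)%N) (fun a b => (a < b)%N)
  =1 fps_div (fps_of_poly (1 - x + x ^+ 2 - x ^+ 2 * y))
             (fps_of_poly (1 - 2 * x + x ^+ 2 - x ^+ 2 * y)).
Proof.
move=> x y.
have numE : 1 - x + x ^+ 2 - x ^+ 2 * y = Poly [:: 1; -1; 1 - 'X].
  by rewrite /= !cons_poly_def /x /y !polyCB !polyCN !polyC1; ring.
have denE : 1 - 2 * x + x ^+ 2 - x ^+ 2 * y = Poly [:: 1; -2; 1 - 'X].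
  by rewrite /= !cons_poly_def /x /y !polyCB !polyCN !polyCD !polyC1; ring.
rewrite numE denE.
apply: fps_div_unique => [|n]; first by rewrite /fps_of_poly coef_Poly unitr1.
rewrite fps_mulC /fps_mul /fps_of_poly coef_Poly.
under eq_bigr do rewrite coef_Poly.
have S0 : antidiag_sum 0 = 1 by rewrite /antidiag_sum big_ord1.
have S1 : antidiag_sum 1 = 2.
  by rewrite /antidiag_sum big_ord_recr big_ord1 /= dec_poly0.
(* The numerator has coefficients only in degrees 0 to 2; from degree 3 on, the claim is
   [antidiag_sumSS]. *)
case: n => [|[|[|n]]].
- by rewrite big_ord1 /= catalan_gf_ge_lt0 mulr1.
- by rewrite !big_ord_recl big_ord0 /= catalan_gf_ge_lt0 catalan_gf_ge_ltS S0; ring.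
- rewrite !big_ord_recl big_ord0 /= catalan_gf_ge_lt0 !catalan_gf_ge_ltS S0 S1.
  ring.
- rewrite !big_ord_recl /= big1 => [|i _]; last by rewrite mul0r.
  rewrite nth_nil /bump /= !subSS !subn0 !catalan_gf_ge_ltS.
  by rewrite antidiag_sumSS; ring.
Qed.
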